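(* (Mehler's formula.) Let $q\in\mathbb{C}$ with $q\neq1$ be such that $[n]_q\neq 0$ for all $n\geq 1$, let $u,\alpha,\beta\in\mathbb{C}$, and let $(a_n^{(\alpha)})_{n\ge0}$, $(a_n^{(\beta)})_{n\ge0}$ be complex sequences with nonzero $0$-th terms. For $\gamma\in\{\alpha,\beta\}$ put $\mathcal{A}_q^{\gamma}(t)=\sum_{n\ge0}a_n^{(\gamma)}\frac{t^n}{[n]_q!}$ and, for $k\ge0$, $\mathcal{A}_{q,k}^{\gamma}(t)=\sum_{n\ge0}a_{n+k}^{(\gamma)}\frac{t^n}{[n]_q!}$. Define $\mathrm{P}_{n,q}^{(\gamma)}(x;u)$ by $\mathcal{A}_q^{\gamma}(t)\mathrm{e}_q(tx,u)=\sum_{n}\mathrm{P}_{n,q}^{(\gamma)}(x;u)\frac{t^n}{[n]_q!}$, $\mathrm{P}_{n,q}^{(\gamma)}(w)=\mathrm{P}_{n,q}^{(\gamma)}(w;1)$, and $\mathrm{Q}_{n,q}^{(\alpha)}(x,y,z;u)=\sum_{k=0}^{n}\genfrac{[}{]}{0pt}{}{n}{k}_{q}\mathrm{P}_{k,q}^{(\alpha)}(x;u)y^kz^{n-k}$. Then, as formal power series in $t$, $$\sum_{n=0}^{\infty}\mathrm{Q}_{n,q}^{(\alpha)}(x,y,z;u)\mathrm{P}_{n,q}^{(\beta)}(w)\frac{t^n}{[n]_q!} =\mathrm{e}_q(wzt)\sum_{i=0}^{\infty}\frac{\mathcal{A}_{q,i}^{\alpha}(ywt)(yt)^i}{[i]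_q!}\sum_{k=0}^{\infty}u^{\binom{k}{2}}\frac{\mathcal{A}_{q,k+i}^{\beta}(zt)\,((1-q)wzt;q)_{k+i}\,(xyt)^k}{[k]_q!}\,\mathrm{e}_q(q^iu^kxywt,u).$$
   Context: $[n]_q=\frac{1-q^n}{1-q}$, $[n]_q!=[1]_q\cdots[n]_q$ ($[0]_q!=1$), $\genfrac{[}{]}{0pt}{}{n}{k}_{q}=\frac{[n]_q!}{[k]_q![n-k]_q!}$. $\mathrm{e}_q(z,u)=\sum_{n\ge0}u^{\binom{n}{2}}\frac{z^n}{[n]_q!}$ (convention $0^0=1$), $\mathrm{e}_q(z)=\mathrm{e}_q(z,1)$. $(a;q)_0=1$, $(a;q)_k=\prod_{j=0}^{k-1}(1-q^ja)$. *)

(* Defs.v *)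
From HB Require Import structures.
From mathcomp Require Import all_boot all_order all_algebra.
From mathcomp Require Import boolp classical_sets functions cardinality fsbigop.
From mathcomp Require Import reals.
From mathcomp.real_closed Require Import complex.

Set Implicit Arguments.
Unset Strict Implicit.
Unset Printing Implicit Defensive.

Import GRing.Theory.
Local Open Scope ring_scope.

(* A record rather than a bare [nat -> K], so that multiplication is the Cauchy
   product and not the pointwise one. *)
Record fps (K : Type) := Fps { fcoef : nat -> K }.

Section FpsAlgebra.
Variable K : fieldType.
Implicit Types f g h : fps K.

Lemma fpsP f g : fcoef f =1 fcoef g -> f = g.
Proof. by case: f => f; case: g => g /= /funext ->. Qed.

HB.instance Definition _ := gen_eqMixin (fps K).
HB.instance Definition _ := gen_choiceMixin (fps K).

Definition fps_zero : fps K := Fps (fun=> 0).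
Definition fps_opp f := Fps (fun n => - fcoef f n).
Definition fps_add f g := Fps (fun n => fcoef f n + fcoef g n).
Definition fps_one : fps K := Fps (fun n => (n == 0)%:R).
Definition fps_mul f g :=
  Fps (fun n => \sum_(k < n.+1) fcoef f k * fcoef g (n - k)).
Definition fps_scale (c : K) f := Fps (fun n => c * fcoef f n).

Fact fps_addA : associative fps_add.
Proof. by move=> f g h; apply: fpsP => n; apply: addrA. Qed.
Fact fps_addC : commutative fps_add.
Proof. by move=> f g; apply: fpsP => n; apply: addrC. Qed.
Fact fps_add0 : left_id fps_zero fps_add.
Proof. by move=> f; apply: fpsP => n; apply: add0r. Qed.
Fact fps_addN : left_inverse fps_zero fps_opp fps_add.
Proof. by move=> f; apply: fpsP => n; apply: addNr. Qed.

HB.instance Definition _ :=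
  GRing.isZmodule.Build (fps K) fps_addA fps_addC fps_add0 fps_addN.

Let trunc N f : {poly K} := \poly_(i < N) fcoef f i.

Let fcoef_mul_trunc N f g n : (n < N)%N ->
  fcoef (fps_mul f g) n = (trunc N f * trunc N g)`_n.
Proof.
move=> ltnN; rewrite coefM /=; apply: eq_bigr => k _.
by rewrite !coef_poly (leq_ltn_trans (leq_ord k)) // (leq_ltn_trans (leq_subr _ _)).
Qed.

Fact fps_mulC : commutative fps_mul.
Proof.
by move=> f g; apply: fpsP => n; rewrite !(@fcoef_mul_trunc n.+1) // mulrC.
Qed.
Fact fps_mulA : associative fps_mul.
Proof.
move=> f g h; apply: fpsP => n.
have -> : fcoef (fps_mul f (fps_mul g h)) n =
    (trunc n.+1 f * (trunc n.+1 g * trunc n.+1 h))`_n.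
  rewrite coefM /=; apply: eq_bigr => k _.
  by rewrite -fcoef_mul_trunc ?ltnS ?leq_subr // coef_poly ltn_ord.
rewrite mulrA coefM /=; apply: eq_bigr => k _.
by rewrite -fcoef_mul_trunc // coef_poly ltnS leq_subr.
Qed.
Fact fps_mul1 : left_id fps_one fps_mul.
Proof.
move=> f; apply: fpsP => n /=; rewrite big_ord_recl /= mul1r subn0 big1 ?addr0 //.
by move=> k _; rewrite mul0r.
Qed.
Fact fps_mulDl : left_distributive fps_mul fps_add.
Proof.
move=> f g h; apply: fpsP => n /=.
by rewrite -big_split; apply: eq_bigr => k _; rewrite mulrDl.
Qed.
Fact fps_one_neq0 : fps_one != 0.
Proof.
by apply/eqP => /(congr1 (fun f => fcoef f 0)) /eqP; rewrite oner_eq0.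
Qed.

HB.instance Definition _ :=
  GRing.Zmodule_isComNzRing.Build (fps K)
    fps_mulA fps_mulC fps_mul1 fps_mulDl fps_one_neq0.

Fact fps_scaleA a b f : fps_scale a (fps_scale b f) = fps_scale (a * b) f.
Proof. by apply: fpsP => n; apply: mulrA. Qed.
Fact fps_scale1 : left_id 1 fps_scale.
Proof. by move=> f; apply: fpsP => n; apply: mul1r. Qed.
Fact fps_scaleDr : right_distributive fps_scale +%R.
Proof. by move=> a f g; apply: fpsP => n; apply: mulrDr. Qed.
Fact fps_scaleDl f : {morph fps_scale^~ f : a b / a + b}.
Proof. by move=> a b; apply: fpsP => n; apply: mulrDl. Qed.

HB.instance Definition _ :=
  GRing.Zmodule_isLmodule.Build K (fps K)
    fps_scaleA fps_scale1 fps_scaleDr fps_scaleDl.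

Fact fps_scaleAl (a : K) f g : a *: (f * g) = (a *: f) * g.
Proof.
apply: fpsP => n /=; rewrite mulr_sumr.
by apply: eq_bigr => k _; rewrite mulrA.
Qed.

HB.instance Definition _ :=
  GRing.Lmodule_isLalgebra.Build K (fps K) fps_scaleAl.
HB.instance Definition _ := GRing.Lalgebra_isComAlgebra.Build K (fps K).

Definition fpsX : fps K := Fps (fun n => (n == 1)%:R).

Definition fps_summable (F : nat -> fps K) :=
  forall n, finite_set [set i | fcoef (F i) n != 0]%classic.

(* The value is meaningful only for a summable family: \sum_(i \in _) is 0
   as soon as the support is infinite. *)
Definition fps_sum (F : nat -> fps K) : fps K :=
  Fps (fun n => \sum_(i \in [set: nat]%classic) fcoef (F i) n).

Lemma fcoef_sum_scaleX (c : nat -> K) (a : K) n :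
  fcoef (fps_sum (fun i => c i *: (a *: fpsX) ^+ i)) n = c n * a ^+ n.
Proof.
have coefXn i m : fcoef (fpsX ^+ i) m = (m == i)%:R.
  elim: i m => [|i IH] [|m] //; rewrite exprS.
    by rewrite /GRing.mul /= big_ord1 mul0r.
  rewrite /GRing.mul /= big_ord_recl /= mul0r add0r big_ord_recl /= mul1r.
  by rewrite /bump /= subSS subn0 IH big1 ?addr0 // => k _; rewrite mul0r.
rewrite /= -(fsbig_widen [set n]%classic) //.
  by rewrite fsbig_set1 exprZn /= coefXn eqxx mulr1.
move=> i [_ /= /eqP /negPf ne_in].
by rewrite exprZn /= coefXn eq_sym ne_in !mulr0.
Qed.

End FpsAlgebra.

Section QCalculus.
Variables (K : fieldType) (q : K).

Definition qint (n : nat) : K := (1 - q ^+ n) / (1 - q).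

Definition qfact (n : nat) : K := \prod_(1 <= i < n.+1) qint i.

Definition qbinom (n k : nat) : K := qfact n / (qfact k * qfact (n - k)).

Definition qpoch (a : fps K) (k : nat) : fps K :=
  \prod_(j < k) (1 - q ^+ j *: a).

(* [qegf c s] is \sum_n c_n s^n / [n]_q!, for s without constant term. *)
Definition qegf (c : nat -> K) (s : fps K) : fps K :=
  fps_sum (fun n => (c n / qfact n) *: s ^+ n).

Lemma fcoef_qegf (c : nat -> K) (b : K) n :
  fcoef (qegf c (b *: fpsX K)) n = c n / qfact n * b ^+ n.
Proof. exact: (fcoef_sum_scaleX (fun n => c n / qfact n)). Qed.

Definition qexp (s : fps K) (u : K) : fps K := qegf (fun n => u ^+ 'C(n, 2)) s.

(* A_q,k(s), the k-fold index shift of A_q(s) = qegf a s. *)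
Definition Aser (a : nat -> K) (k : nat) (s : fps K) : fps K :=
  qegf (fun n => a (n + k)%N) s.

(* Coefficient extraction from A_q(t) e_q(t x, u) = \sum_n P_n(x; u) t^n / [n]_q!;
   [qegf_Ppol] recovers this identity. *)
Definition Ppol (a : nat -> K) (n : nat) (x u : K) : K :=
  qfact n * fcoef (qegf a (fpsX K) * qexp (x *: fpsX K) u) n.

Lemma qegf_Ppol (a : nat -> K) (x u : K) :
  (forall n, (1 <= n)%N -> qint n != 0) ->
  qegf a (fpsX K) * qexp (x *: fpsX K) u =
  qegf (fun n => Ppol a n x u) (fpsX K).
Proof.
move=> q_ok; apply: fpsP => n.
have nf_neq0 : qfact n != 0.
  rewrite /qfact prodf_seq_neq0; apply/allP => i.
  by rewrite mem_index_iota => /andP[/q_ok].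
rewrite -[in RHS](scale1r (fpsX K)) fcoef_qegf expr1n mulr1 /Ppol.
by rewrite mulrAC divff // mul1r.
Qed.

Definition Qpol (a : nat -> K) (n : nat) (x y z u : K) : K :=
  \sum_(k < n.+1) qbinom n k * Ppol a k x u * y ^+ k * z ^+ (n - k).

End QCalculus.

(* Main.v *)
Require Import Defs.
From mathcomp Require Import all_boot all_order all_algebra.
From mathcomp Require Import classical_sets cardinality fsbigop.
From mathcomp Require Import reals.
From mathcomp.real_closed Require Import complex.
From mathcomp Require Import ring.

(* The q-derivative shifts coefficients: D (\sum_n c_n t^n / [n]_q!) =
   \sum_n c_(n+1) t^n / [n]_q!, and obeys the q-Leibniz rule
   D^k (f g) = \sum_j [k, j]_q (D^j f)(t) (D^(k-j) g)(q^j t).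
   On the left-hand side, summing over n - k for fixed k produces the k-th
   shift of \sum_n P_n^(beta)(w) s^n / [n]_q! = A^beta(s) e_q(w s) at s = z t.
   The rule, with e_q(q^j s) = ((1 - q) s; q)_j e_q(s), expands it as a sum
   over j of A^beta_j; collecting by j, the remaining sum is the j-th shift of
   A^alpha(s) e_q(x s, u) at s = y w t, which the rule expands a second time. *)

Set Implicit Arguments.
Unset Strict Implicit.

Import GRing.Theory.
Local Open Scope ring_scope.
Local Open Scope complex_scope.

(** * Power series: vanishing order, infinite sums, dilation *)

Section PowerSeries.
Variable K : fieldType.
Implicit Types (f g : fps K) (F : nat -> fps K) (G : nat -> nat -> fps K).

(** Divisibility by [t^m]. When [F i] has order at least [i], only the indices [i <= n] reach
    coefficient [n], so infinite sums become finite ones. *)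
Definition order_ge (m : nat) f := forall n, (n < m)%N -> fcoef f n = 0.

Lemma fcoefM f g n :
  fcoef (f * g) n = \sum_(k < n.+1) fcoef f k * fcoef g (n - k).
Proof. by []. Qed.

Lemma fcoefZ (c : K) f n : fcoef (c *: f) n = c * fcoef f n.
Proof. by []. Qed.

Lemma fcoefB f g n : fcoef (f - g) n = fcoef f n - fcoef g n.
Proof. by []. Qed.

Lemma fcoef_sumr n (P : 'I_n -> fps K) m :
  fcoef (\sum_(i < n) P i) m = \sum_(i < n) fcoef (P i) m.
Proof. exact: (big_morph (fun f => fcoef f m)). Qed.

Lemma fcoef_monomial (b : K) i n :
  fcoef ((b *: fpsX K) ^+ i) n = (n == i)%:R * b ^+ i.
Proof.
rewrite exprZn [LHS]mulrC; congr (_ * _).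
elim: i n => [|i IH] [|n] //; rewrite exprS fcoefM.
  by rewrite big_ord1 mul0r.
rewrite big_ord_recl mul0r add0r big_ord_recl mul1r.
by rewrite /bump /= subSS subn0 IH big1 ?addr0 // => k _; rewrite mul0r.
Qed.

Lemma fcoef_monomialM (b : K) i f n : (i <= n)%N ->
  fcoef ((b *: fpsX K) ^+ i * f) n = b ^+ i * fcoef f (n - i).
Proof.
move=> le_in; have lt_in : (i < n.+1)%N by [].
rewrite fcoefM (bigD1 (Ordinal lt_in)) //= fcoef_monomial eqxx mul1r big1 ?addr0 //.
by move=> k; rewrite -val_eqE fcoef_monomial /= => /negPf ->; rewrite !mul0r.
Qed.

Lemma order_ge_monomial (b : K) i : order_ge i ((b *: fpsX K) ^+ i).
Proof. by move=> n lt_ni; rewrite fcoef_monomial ltn_eqF // mul0r. Qed.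

Lemma order_geM m n f g : order_ge m f -> order_ge n g -> order_ge (m + n) (f * g).
Proof.
move=> f_m g_n p lt_p; rewrite fcoefM big1 // => k _.
have [lt_km | le_mk] := ltnP k m; first by rewrite f_m // mul0r.
have le_kp : (k <= p)%N by rewrite -ltnS.
rewrite g_n ?mulr0 // -(ltn_add2l k) subnKC //.
by apply: (leq_trans lt_p); rewrite leq_add2r.
Qed.

Lemma order_geMl m f g : order_ge m f -> order_ge m (g * f).
Proof. by move=> f_m; apply: (@order_geM 0 m). Qed.

Lemma order_geMr m f g : order_ge m f -> order_ge m (f * g).
Proof. by move=> f_m; rewrite mulrC; apply: order_geMl. Qed.

Lemma order_geZ m (c : K) f : order_ge m f -> order_ge m (c *: f).
Proof. by move=> f_m n /f_m fn0; rewrite /GRing.scale /= fn0 mulr0. Qed.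

Lemma order_ge_summable F : (forall i, order_ge i (F i)) -> fps_summable F.
Proof.
move=> ordF n; apply: (@sub_finite_set _ _ `I_n.+1); last exact: finite_II.
move=> i /= Fin; rewrite ltnS leqNgt; apply/negP => /ordF Fi0.
by rewrite Fi0 eqxx in Fin.
Qed.

(** The bound [N] is free above [n], so that nested sums and coefficients of different index can
    share one range. *)
Lemma fcoef_fps_sum F n N : (forall i, order_ge i (F i)) -> (n < N)%N ->
  fcoef (fps_sum F) n = \sum_(i < N) fcoef (F i) n.
Proof.
move=> ordF lt_nN; rewrite [RHS](fsbig_ord +%R N (fun i => fcoef (F i) n)) /=.
apply/esym/fsbig_widen => // i [_ /= iN].
by apply: ordF; apply: leq_trans lt_nN _; rewrite leqNgt; apply/negP.
Qed.

Lemma eq_fps_sum F F' : (forall i, F i = F' i) -> fps_sum F = fps_sum F'.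
Proof.
by move=> eqF; apply: fpsP => n /=; apply: eq_fsbigr => i _; rewrite eqF.
Qed.

Lemma mulr_fps_sumr f F : (forall i, order_ge i (F i)) ->
  f * fps_sum F = fps_sum (fun i => f * F i).
Proof.
move=> ordF; apply: fpsP => n.
rewrite (@fcoef_fps_sum _ _ n.+1) //; last by move=> i; apply: order_geMl.
rewrite fcoefM (eq_bigr (fun k : 'I_n.+1 =>
  \sum_(i < n.+1) fcoef f k * fcoef (F i) (n - k))).
  by rewrite exchange_big; apply: eq_bigr => i _; rewrite fcoefM.
by move=> k _; rewrite (@fcoef_fps_sum _ _ n.+1) ?ltnS ?leq_subr // mulr_sumr.
Qed.

(** Raising [n] by one adds the antidiagonal [i + k = n], that is, one more entry to each row
    [i]. *)
Lemma sum_antidiagonal (V : nmodType) (h : nat -> nat -> V) n :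
  \sum_(j < n) \sum_(i < j.+1) h i (j - i)%N =
  \sum_(i < n) \sum_(k < n - i) h i k.
Proof.
elim: n => [|n IH]; first by rewrite !big_ord0.
rewrite big_ord_recr IH [in RHS]big_ord_recr /= subSnn big_ord1.
rewrite [X in _ + X]big_ord_recr /= subnn addrA; congr (_ + _).
rewrite -big_split; apply: eq_bigr => i _ /=.
by rewrite subSn 1?ltnW // big_ord_recr.
Qed.

Lemma fps_sum_antidiagonal G :
  (forall i k, order_ge (i + k) (G i k)) ->
  fps_sum (fun j => \sum_(i < j.+1) G i (j - i)%N) =
  fps_sum (fun i => fps_sum (G i)).
Proof.
move=> ordG; apply: fpsP => n.
have ordG1 i k : order_ge k (G i k).
  by move=> m lt_mk; apply: ordG; apply: ltn_addl.
rewrite (@fcoef_fps_sum _ _ n.+1) //; last first.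
  move=> j m lt_mj; rewrite fcoef_sumr big1 // => i _.
  by apply: ordG; rewrite subnKC // -ltnS.
rewrite (@fcoef_fps_sum _ _ n.+1) //; last first.
  move=> i m lt_mi; rewrite (@fcoef_fps_sum _ _ m.+1) // big1 // => k _.
  by apply: ordG; apply: ltn_addr.
rewrite (eq_bigr (fun j : 'I_n.+1 => \sum_(i < j.+1) fcoef (G i (j - i)%N) n));
  last by move=> j _; rewrite fcoef_sumr.
rewrite (sum_antidiagonal (fun i k => fcoef (G i k) n)).
apply: eq_bigr => i _; rewrite (@fcoef_fps_sum _ _ n.+1) //.
(* The triangular row is widened to the full range; the added terms have [i + k > n] and vanish by
   the order hypothesis. *)
rewrite (big_ord_widen _ (fun k => fcoef (G i k) n) (leq_subr i n.+1)).
rewrite big_mkcond; apply: eq_bigr => k _; case: ltnP => // le_k.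
by rewrite ordG // -ltnS ltnS -leq_subLR.
Qed.

Definition fps_dilate (b : K) f := Fps (fun n => b ^+ n * fcoef f n).

Lemma fcoef_dilate b f n : fcoef (fps_dilate b f) n = b ^+ n * fcoef f n.
Proof. by []. Qed.

Lemma fps_dilateM b : {morph fps_dilate b : f g / f * g}.
Proof.
move=> f g; apply: fpsP => n; rewrite /= mulr_sumr; apply: eq_bigr => k _.
by rewrite mulrACA -exprD subnKC // -ltnS.
Qed.

Lemma fps_dilate_sum b n (P : 'I_n -> fps K) :
  fps_dilate b (\sum_(i < n) P i) = \sum_(i < n) fps_dilate b (P i).
Proof.
apply: fpsP => m /=; rewrite !fcoef_sumr mulr_sumr; exact: eq_bigr.
Qed.

Lemma fps_dilateZ b (c : K) f : fps_dilate b (c *: f) = c *: fps_dilate b f.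
Proof. by apply: fpsP => n; rewrite /= mulrCA. Qed.

End PowerSeries.

(** * The q-derivative and the q-Leibniz rule *)

Section QSeries.
Variables (K : fieldType) (q : K).
Hypothesis q_ok : forall n, (1 <= n)%N -> qint q n != 0.
Implicit Types (f g : fps K) (a c d : nat -> K).

Lemma subr1q_neq0 : 1 - q != 0.
Proof.
(* At [q = 1] the quotient [qint q 1] would be 0/0, which is 0 by convention. *)
apply/eqP => q1; have /eqP := q_ok (leqnn 1).
by rewrite /qint expr1 q1 mul0r.
Qed.

Lemma qint0 : qint q 0 = 0.
Proof. by rewrite /qint expr0 subrr mul0r. Qed.

(** The asymmetry is the source of the twist by [q] in the product rule, and it gives the q-Pascal
    recursion behind its iterates. *)
Lemma qintD m n : qint q (m + n) = qint q m * q ^+ n + qint q n.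
Proof. by rewrite /qint exprD; field; exact: subr1q_neq0. Qed.

Lemma qfact0 : qfact q 0 = 1.
Proof. by rewrite /qfact big_geq. Qed.

Lemma qfactS n : qfact q n.+1 = qint q n.+1 * qfact q n.
Proof. by rewrite /qfact big_nat_recr //= mulrC. Qed.

Lemma qfact_neq0 n : qfact q n != 0.
Proof.
by elim: n => [|n IH]; rewrite ?qfact0 ?oner_neq0 // qfactS mulf_neq0 // q_ok.
Qed.

(** The Jackson derivative [(f(t) - f(q t)) / ((1 - q) t)], given on coefficients to avoid dividing
    by [t]. *)
Definition qderiv f := Fps (fun n => qint q n.+1 * fcoef f n.+1).

Lemma fcoef_qderiv f n : fcoef (qderiv f) n = qint q n.+1 * fcoef f n.+1.
Proof. by []. Qed.

Lemma qderivZ (c : K) f : qderiv (c *: f) = c *: qderiv f.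
Proof. by apply: fpsP => n; rewrite /= mulrCA. Qed.

Lemma qderiv_sum n (P : 'I_n -> fps K) :
  qderiv (\sum_(i < n) P i) = \sum_(i < n) qderiv (P i).
Proof.
apply: fpsP => m /=; rewrite !fcoef_sumr mulr_sumr; exact: eq_bigr.
Qed.

Lemma qderivM f g : qderiv (f * g) = qderiv f * fps_dilate q g + f * qderiv g.
Proof.
apply: fpsP => n; rewrite /= mulr_sumr.
(* Splitting [[n+1] = [k] q^(n+1-k) + [n+1-k]], the first part differentiates [f] and dilates [g],
   the second differentiates [g]. Each part loses one end term because [[0] = 0]. *)
rewrite (eq_bigr (fun k : 'I_n.+2 =>
  qint q k * fcoef f k * (q ^+ (n.+1 - k) * fcoef g (n.+1 - k)) +
  fcoef f k * (qint q (n.+1 - k) * fcoef g (n.+1 - k)))); last first.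
  move=> k _; have le_kn : (k <= n.+1)%N by rewrite -ltnS.
  have -> : qint q n.+1 = qint q k * q ^+ (n.+1 - k) + qint q (n.+1 - k).
    by rewrite -qintD subnKC.
  by ring.
rewrite big_split /= big_ord_recl /= qint0 !mul0r add0r; congr (_ + _).
rewrite big_ord_recr /= subnn qint0 mul0r mulr0 addr0.
by apply: eq_bigr => k _; rewrite subSn // -ltnS.
Qed.

Lemma qderiv_dilate b f : qderiv (fps_dilate b f) = b *: fps_dilate b (qderiv f).
Proof. by apply: fpsP => n; rewrite /= exprS; ring. Qed.

(* Dividing by [k]_q! makes the q-Leibniz rule free of q-binomials. *)
Definition qtaylor k f := (qfact q k)^-1 *: iter k qderiv f.

Lemma qderiv_qtaylor k f : qderiv (qtaylor k f) = qint q k.+1 *: qtaylor k.+1 f.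
Proof.
rewrite /qtaylor qderivZ scalerA qfactS invfM mulrA divff ?mul1r //.
exact: q_ok.
Qed.

Lemma qtaylorM k f g :
  qtaylor k (f * g) =
  \sum_(j < k.+1) qtaylor j f * fps_dilate (q ^+ j) (qtaylor (k - j) g).
Proof.
elim: k => [|k IH].
  rewrite big_ord1 /qtaylor qfact0 invr1 !scale1r /=; congr (_ * _).
  by apply: fpsP => n; rewrite /= expr0 expr1n mul1r.
(* After multiplication by [[k+1]] the left side is the q-derivative of the previous case. *)
apply: (scalerI (q_ok (ltn0Sn k))); rewrite -qderiv_qtaylor IH qderiv_sum.
rewrite scaler_sumr.
pose T j m := qtaylor j f * fps_dilate (q ^+ j) (qtaylor m g).
(* The two parts of [[k+1] = [j] + q^j [k+1-j]] match the two terms of the product rule; the first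
   is reindexed by [j + 1]. *)
rewrite [RHS](eq_bigr (fun j : 'I_k.+2 => qint q j *: T j (k.+1 - j)%N +
   (q ^+ j * qint q (k.+1 - j)) *: T j (k.+1 - j)%N)); last first.
  move=> j _; have le_jk : (j <= k.+1)%N by rewrite -ltnS.
  by rewrite -scalerDl -{1}(subnK le_jk) qintD addrC mulrC.
rewrite [RHS]big_split /= [in RHS]big_ord_recl /= qint0 scale0r add0r.
rewrite [X in _ = _ + X]big_ord_recr /= subnn qint0 mulr0 scale0r addr0.
rewrite -big_split; apply: eq_bigr => j _ /=.
have le_jk : (j <= k)%N by rewrite -ltnS.
rewrite qderivM qderiv_dilate !qderiv_qtaylor fps_dilateZ /bump add1n subSS.
rewrite subSn // -scalerAl -!scalerAr scalerA; congr (_ *: (_ * _) + _).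
by apply: fpsP => n; rewrite /= mulrA -exprMn -exprS.
Qed.

(** * Index shifts of generating functions and of the q-exponential *)

Lemma eq_qegf c d s : c =1 d -> qegf q c s = qegf q d s.
Proof. by move=> eq_cd; apply: eq_fps_sum => n; rewrite eq_cd. Qed.

Lemma fps_dilate_qegf (b e : K) c :
  fps_dilate b (qegf q c (e *: fpsX K)) = qegf q c ((b * e) *: fpsX K).
Proof. by apply: fpsP => n; rewrite fcoef_dilate !fcoef_qegf exprMn mulrCA. Qed.

Lemma qderiv_qegf c :
  qderiv (qegf q c (fpsX K)) = qegf q (fun n => c n.+1) (fpsX K).
Proof.
apply: fpsP => n; rewrite fcoef_qderiv -(scale1r (fpsX K)) !fcoef_qegf qfactS !expr1n.
by field; rewrite q_ok ?qfact_neq0.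
Qed.

Lemma qtaylor_qegf k c :
  qtaylor k (qegf q c (fpsX K)) = (qfact q k)^-1 *: Aser q c k (fpsX K).
Proof.
congr (_ *: _); rewrite /Aser; elim: k => [|k IH] /=.
  by apply: eq_qegf => n; rewrite addn0.
by rewrite IH qderiv_qegf; apply: eq_qegf => n; rewrite addSnnS.
Qed.

(** The q-Leibniz rule on coefficient sequences. Substituting [b t] only after differentiating
    avoids the powers of [b] that [qderiv_dilate] would produce. *)
Lemma Aser_product k (b : K) c d p :
  qegf q c (fpsX K) * qegf q d (fpsX K) = qegf q p (fpsX K) ->
  (qfact q k)^-1 *: Aser q p k (b *: fpsX K) =
  \sum_(j < k.+1) ((qfact q j)^-1 / qfact q (k - j)) *:
     (Aser q c j (b *: fpsX K) *
      Aser q d (k - j) ((q ^+ j * b) *: fpsX K)).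
Proof.
move=> def_p.
have dilA e i : Aser q e i (b *: fpsX K) = fps_dilate b (Aser q e i (fpsX K)).
  by rewrite -{2}(scale1r (fpsX K)) /Aser fps_dilate_qegf mulr1.
rewrite dilA -fps_dilateZ -qtaylor_qegf -def_p qtaylorM fps_dilate_sum.
apply: eq_bigr => j _; rewrite !qtaylor_qegf !fps_dilateZ -scalerAl -scalerAr.
rewrite scalerA fps_dilateZ fps_dilateM dilA; congr (_ *: (_ * _)).
by rewrite mulrC -{1}(scale1r (fpsX K)) /Aser !fps_dilate_qegf mulr1.
Qed.

Lemma qexpE (x u : K) :
  qexp q (x *: fpsX K) u = qegf q (fun n => u ^+ 'C(n, 2) * x ^+ n) (fpsX K).
Proof.
apply: fpsP => n; rewrite -(scale1r (fpsX K)) scalerA !fcoef_qegf.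
by rewrite mulr1 expr1n mulr1 mulrAC.
Qed.

(** In [C(n+k, 2) = C(k, 2) + C(n, 2) + k n] the cross term becomes a dilation of the argument by
    [u^k]. *)
Lemma Aser_qexp k (b x u : K) :
  Aser q (fun n => u ^+ 'C(n, 2) * x ^+ n) k (b *: fpsX K) =
  (u ^+ 'C(k, 2) * x ^+ k) *: qexp q ((u ^+ k * x * b) *: fpsX K) u.
Proof.
have binD n : 'C(n + k, 2) = ('C(k, 2) + 'C(n, 2) + k * n)%N.
  elim: n => [|n IH]; first by rewrite muln0 addn0 addn0.
  by rewrite addSn !binS IH !bin1 mulnS; ring.
apply: fpsP => n; rewrite fcoefZ !fcoef_qegf binD !exprD !exprMn exprM.
by ring.
Qed.

Lemma Aser_Ppol a k (b x u : K) :
  (qfact q k)^-1 *: Aser q (fun n => Ppol q a n x u) k (b *: fpsX K) =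
  \sum_(j < k.+1) (u ^+ 'C(k - j, 2) * x ^+ (k - j) /
      (qfact q j * qfact q (k - j))) *:
     (Aser q a j (b *: fpsX K) *
      qexp q ((q ^+ j * u ^+ (k - j) * x * b) *: fpsX K) u).
Proof.
have prodE := qegf_Ppol a x u q_ok; rewrite qexpE in prodE.
rewrite (Aser_product k b prodE); apply: eq_bigr => j _.
rewrite Aser_qexp -scalerAr scalerA; congr (_ *: (_ * qexp _ (_ *: _) _)).
  by rewrite invfM mulrC.
by ring.
Qed.

(** This is [D e = e] for the q-exponential, in the form [e(s) - e(q s) = (1 - q) s e(s)]. *)
Lemma qexp1_dilate (b : K) :
  qexp q ((q * b) *: fpsX K) 1 =
  (1 - ((1 - q) * b) *: fpsX K) * qexp q (b *: fpsX K) 1.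
Proof.
apply: fpsP => -[|n]; rewrite mulrBl mul1r.
  rewrite fcoefB fcoefM big_ord1 fcoefZ [fcoef (fpsX K) _]/= mulr0 mul0r subr0.
  by rewrite !fcoef_qegf !expr0.
rewrite -[((1 - q) * b) *: fpsX K]expr1.
rewrite fcoefB fcoef_monomialM // expr1 subn1 [n.+1.-1]/= !fcoef_qegf !expr1n.
rewrite qfactS /qint; set p := qfact q n; have := q_ok (ltn0Sn n).
rewrite /qint mulf_eq0 => /norP[h _].
have := qfact_neq0 n; rewrite -/p exprMn !exprS => hp.
by field; rewrite hp subr1q_neq0 -exprS.
Qed.

Lemma qexp1_dilate_iter j (b : K) :
  qexp q ((q ^+ j * b) *: fpsX K) 1 =
  qpoch q (((1 - q) * b) *: fpsX K) j * qexp q (b *: fpsX K) 1.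
Proof.
elim: j => [|j IH]; first by rewrite /qpoch big_ord0 expr0 !mul1r.
rewrite exprS -mulrA qexp1_dilate IH mulrA /qpoch big_ord_recr /=.
by congr (_ * _); rewrite mulrC scalerA mulrCA.
Qed.

(** At [u = 1] the exponentials in [Aser_Ppol] are dilations by [q^j] of a single series, so it
    factors out and leaves q-Pochhammer symbols. *)
Lemma Aser_Ppol1 a k (b w : K) :
  (qfact q k)^-1 *: Aser q (fun n => Ppol q a n w 1) k (b *: fpsX K) =
  qexp q ((w * b) *: fpsX K) 1 *
  \sum_(j < k.+1) (w ^+ (k - j) / (qfact q j * qfact q (k - j))) *:
     (Aser q a j (b *: fpsX K) * qpoch q (((1 - q) * (w * b)) *: fpsX K) j).
Proof.
rewrite Aser_Ppol mulr_sumr; apply: eq_bigr => j _.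
rewrite !expr1n mulr1 mul1r -mulrA qexp1_dilate_iter -scalerAr.
by congr (_ *: _); rewrite mulrA mulrC.
Qed.

(** * The double series of Mehler's formula *)

Definition mehler_term a c (x y z w u : K) i k : fps K :=
  ((qfact q i)^-1 * (u ^+ 'C(k, 2) / qfact q k)) *:
    (Aser q a i ((y * w) *: fpsX K) * (y *: fpsX K) ^+ i *
     (Aser q c (k + i) (z *: fpsX K)
      * qpoch q (((1 - q) * w * z) *: fpsX K) (k + i)
      * ((x * y) *: fpsX K) ^+ k
      * qexp q ((q ^+ i * u ^+ k * x * y * w) *: fpsX K) u)).

Lemma order_ge_mehler_term a c x y z w u i k :
  order_ge (i + k) (mehler_term a c x y z w u i k).
Proof.
apply: order_geZ; apply: order_geM.
  by apply: order_geMl; apply: order_ge_monomial.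
by apply/order_geMr/order_geMl/order_ge_monomial.
Qed.

(** In coefficient [n] the [[n]_q!] of the q-binomial cancels; the remaining [[n-k]_q!] is the
    denominator of coefficient [n - k] in the [k]-th shift at [z t]. *)
Lemma qegf_Qpol_Ppol_shift a c (x y z w u : K) :
  qegf q (fun n => Qpol q a n x y z u * Ppol q c n w 1) (fpsX K) =
  fps_sum (fun k => Ppol q a k x u *: ((y *: fpsX K) ^+ k *
    ((qfact q k)^-1 *: Aser q (fun n => Ppol q c n w 1) k (z *: fpsX K)))).
Proof.
apply: fpsP => n; rewrite (@fcoef_fps_sum _ _ _ n.+1) //; last first.
  by move=> k; apply/order_geZ/order_geMr/order_ge_monomial.
rewrite -[fpsX K in LHS]scale1r fcoef_qegf expr1n mulr1 /Qpol !mulr_suml.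
apply: eq_bigr => k _; have le_kn : (k <= n)%N by rewrite -ltnS.
rewrite fcoefZ fcoef_monomialM // fcoefZ fcoef_qegf subnK // /qbinom.
by field; rewrite !qfact_neq0.
Qed.

Lemma qegf_Qpol_Ppol a c (x y z w u : K) :
  qegf q (fun n => Qpol q a n x y z u * Ppol q c n w 1) (fpsX K) =
  qexp q ((w * z) *: fpsX K) 1 *
  fps_sum (fun i => fps_sum (mehler_term a c x y z w u i)).
Proof.
rewrite qegf_Qpol_Ppol_shift.
pose C j := (y *: fpsX K) ^+ j *
  (Aser q c j (z *: fpsX K) * qpoch q (((1 - q) * w * z) *: fpsX K) j).
(* Here [j] is the Leibniz index of the beta expansion and [m = k - j]; [C j] gathers the factors
   independent of [m]. *)
pose G j m := (Ppol q a (m + j) x u / (qfact q j * qfact q m)) *: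
  (C j * ((y * w) *: fpsX K) ^+ m).
have ordG j m : order_ge (j + m) (G j m).
  apply/order_geZ/order_geM; last exact: order_ge_monomial.
  exact/order_geMr/order_ge_monomial.
have ordH := order_ge_mehler_term a c x y z w u.
(* The target is regrouped by [j = i + k], the shift carried by the beta series. *)
rewrite -(fps_sum_antidiagonal ordH).
(* Summing over [m] rebuilds the [j]-th shift of the alpha series at [y w t]; its Leibniz expansion
   gives the terms with [i + k = j]. *)
have sumG j : fps_sum (G j) = \sum_(i < j.+1) mehler_term a c x y z w u i (j - i).
  transitivity (C j * ((qfact q j)^-1 *:
      Aser q (fun n => Ppol q a n x u) j ((y * w) *: fpsX K))).
    rewrite -scalerAr scalerAl mulr_fps_sumr; last first.
      by move=> m; apply/order_geZ/order_ge_monomial.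
    apply: eq_fps_sum => m; rewrite -scalerAr -scalerAl scalerA /G invfM.
    by rewrite mulrA mulrAC.
  rewrite Aser_Ppol mulr_sumr; apply: eq_bigr => i _.
  have le_ij : (i <= j)%N by rewrite -ltnS.
  have expt_j : (y *: fpsX K) ^+ j = (y *: fpsX K) ^+ i * (y *: fpsX K) ^+ (j - i).
    by rewrite -exprD subnKC.
  rewrite /mehler_term /C subnK // expt_j -(scalerA x y) (exprZn x (y *: fpsX K)).
  rewrite -!mulrA -!(scalerAr, scalerAl) !scalerA; congr (_ *: _).
    by rewrite invfM; ring.
  by rewrite !mulrA; ring.
(* The beta expansion turns the [k]-th summand into the antidiagonal [j + m = k] of [G], with [w^m]
   absorbed into [(y w t)^m]. *)
transitivity (fps_sum (fun k => qexp q ((w * z) *: fpsX K) 1 *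
    \sum_(j < k.+1) G j (k - j)%N)).
  apply: eq_fps_sum => k; rewrite Aser_Ppol1 mulrCA scalerAr.
  congr (_ * _); rewrite mulr_sumr scaler_sumr; apply: eq_bigr => j _.
  have le_jk : (j <= k)%N by rewrite -ltnS.
  have expt_k : (y *: fpsX K) ^+ k = (y *: fpsX K) ^+ j * (y *: fpsX K) ^+ (k - j).
    by rewrite -exprD subnKC.
  rewrite /G /C subnK // expt_k (mulrC y) -(scalerA w y) (exprZn w (y *: fpsX K)).
  rewrite -!(scalerAr, scalerAl) !scalerA; congr (_ *: _).
    by rewrite [RHS]mulrAC !mulrA mulrAC.
  by rewrite (mulrA (1 - q)); ring.
rewrite -mulr_fps_sumr; last first.
  move=> k n lt_nk; rewrite fcoef_sumr big1 // => j _.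
  by apply: ordG; rewrite subnKC // -ltnS.
by rewrite (fps_sum_antidiagonal ordG) (eq_fps_sum sumG).
Qed.

End QSeries.

Theorem theorem16 (R : realType) (q u alpha beta : R[i])
    (a : R[i] -> nat -> R[i]) (x y z w : R[i]) :
  q != 1 ->
  (forall n : nat, (1 <= n)%N -> qint q n != 0) ->
  a alpha 0%N != 0 ->
  a beta 0%N != 0 ->
  let t := fpsX R[i] in
  let inner (i k : nat) : fps R[i] :=
    (u ^+ 'C(k, 2) / qfact q k) *:
      (Aser q (a beta) (k + i) (z *: t)
       * qpoch q (((1 - q) * w * z) *: t) (k + i)
       * ((x * y) *: t) ^+ k
       * qexp q ((q ^+ i * u ^+ k * x * y * w) *: t) u) in
  let outer (i : nat) : fps R[i] :=
    (qfact q i)^-1 *: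
      (Aser q (a alpha) i ((y * w) *: t) * (y *: t) ^+ i
       * fps_sum (inner i)) in
  [/\ forall i : nat, fps_summable (inner i),
      fps_summable outer
    & qegf q (fun n => Qpol q (a alpha) n x y z u * Ppol q (a beta) n w 1) t
      = qexp q ((w * z) *: t) 1 * fps_sum outer].
Proof.
move=> _ q_ok _ _ t inner outer.
have ord_inner i k : order_ge k (inner i k).
  by apply/order_geZ/order_geMr/order_geMl/order_ge_monomial.
split=> [i||]; first exact: order_ge_summable.
  apply: order_ge_summable => i.
  by apply/order_geZ/order_geMr/order_geMl/order_ge_monomial.
rewrite qegf_Qpol_Ppol //; congr (_ * _); apply: eq_fps_sum => i.
(* The prefactor of index [i] moves under the sum over [k], producing [mehler_term]. *)
rewrite /outer scalerAl mulr_fps_sumr //; apply: eq_fps_sum => k.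
rewrite -[RHS]scalerAl /mehler_term -[LHS]scalerA; congr (_ *: _); exact: scalerAr.
Qed.
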